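(* Let $d\ge2$ be an integer and fix a prime $p$. If the set $\{n : p\mid D_d(0,n)\}$ is infinite, then the map $R_d:\mathbb{A}^3\to\mathbb{A}^3$, $$R_d(x,y,z)=(y,\;y^d+y-x^d,\;d\,x^{d-1}z+1),$$ has a non-periodic subvariety with infinitely many periodic points over $\overline{\mathbb{F}_p}$.
   Context: Let $f_{d,c}(z)=z^d+c$, with $f_{d,c}^k$ its $k$-th iterate, and let $\mu$ be the Möbius function. For $n\ge1$, $G_d(0,n)=\prod_{k\mid n}\left(f_{d,c}^k(0)\right)^{\mu(n/k)}$, a polynomial in $c$ with integer coefficients, and $D_d(0,n)=\operatorname{Disc}(G_d(0,n))$ is its discriminant as a polynomial in $c$ (the discriminant of a degree one polynomial being $1$). A subvariety $V\subset\mathbb{A}^3$ over $\overline{\mathbb{F}_p}$ is periodic for $R_d$ if $R_d^N(V)\subseteq V$ for some $N\ge1$. *)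

(* Defs.v *)
From HB Require Import structures.
From mathcomp Require Import all_boot all_order all_algebra all_field.
From mathcomp Require Import fraction mpoly.
From mathcomp Require Import classical_sets cardinality.
Set Implicit Arguments.
Unset Strict Implicit.
Unset Printing Implicit Defensive.
Import GRing.Theory.
Local Open Scope ring_scope.
Local Open Scope classical_set_scope.

(* Only meant for n >= 1. *)
Definition mobius (n : nat) : int :=
  if all (fun q => logn q n == 1%N) (primes n)
  then (-1) ^+ size (primes n) else 0.

(* For g of degree m and leading coefficient a, this is
   (-1)^(m(m-1)/2) Res(g, g') / a.  Over Z the division by a is exact, g' has
   degree m - 1, and the value is 1 when m = 1.  MathComp's [resultant] differs
   from the usual one by the sign (-1)^(deg g * deg g'), which is 1 here. *)
Definition disc (g : {poly int}) : int :=
  ((-1) ^+ 'C((size g).-1, 2) * resultant g g^`() %/ lead_coef g)%Z.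

Definition fdc (A : comNzRingType) (d : nat) (c z : A) : A := z ^+ d + c.

(* f_{d,c}^k(0) as a polynomial in the indeterminate c = 'X. *)
Definition crit_orbit (d k : nat) : {poly int} := iter k (fdc d 'X) 0.

Definition gleason_frac (d n : nat) : {fraction {poly int}} :=
  \prod_(k <- divisors n) tofrac (crit_orbit d k) ^ mobius (n %/ k).

(* The polynomial equal to the fraction above.  It is unique because [tofrac]
   is injective, and it exists for all d >= 2 and n >= 1, so the default value 1
   of [xget] is never used for such d and n. *)
Definition gleason (d n : nat) : {poly int} :=
  xget 1 [set g | tofrac g = gleason_frac d n].

Definition gleason_disc (d n : nat) : int := disc (gleason d n).

Section AffineSpace.
Variables (K : closedFieldType) (n : nat).

(* As K is algebraically closed, a subvariety of the affine n-space over K is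
   represented by its set of K-points. *)
Definition zero_locus (S : set {mpoly K[n]}) : set (n.-tuple K) :=
  [set v | forall q, S q -> q.@[tnth v] = 0].

Definition zariski_closed (V : set (n.-tuple K)) : Prop :=
  exists S : set {mpoly K[n]}, V = zero_locus S.

Definition irreducible_set (V : set (n.-tuple K)) : Prop :=
  V !=set0 /\
  forall A B, zariski_closed A -> zariski_closed B ->
    V `<=` A `|` B -> V `<=` A \/ V `<=` B.

Definition subvariety (V : set (n.-tuple K)) : Prop :=
  zariski_closed V /\ irreducible_set V.

Definition periodic_subset (F : n.-tuple K -> n.-tuple K)
    (V : set (n.-tuple K)) : Prop :=
  exists2 N : nat, (0 < N)%N & iter N F @` V `<=` V.

Definition periodic_point (F : n.-tuple K -> n.-tuple K)
    (v : n.-tuple K) : Prop :=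
  exists2 N : nat, (0 < N)%N & iter N F v = v.

End AffineSpace.

Definition Rmap (K : closedFieldType) (d : nat) (v : 3.-tuple K) :
    3.-tuple K :=
  let x := v`_0 in let y := v`_1 in let z := v`_2 in
  [tuple y; y ^+ d + y - x ^+ d; d%:R * x ^+ d.-1 * z + 1].

(* Main.v *)
Require Import Defs.
From HB Require Import structures.
From mathcomp Require Import all_boot all_order all_algebra all_field.
From mathcomp Require Import fraction mpoly.
From mathcomp Require Import boolp classical_sets cardinality.
Set Implicit Arguments.
Unset Strict Implicit.
Unset Printing Implicit Defensive.
Import GRing.Theory.
Local Open Scope ring_scope.
Local Open Scope classical_set_scope.

(** Let a_k(c) be the k-th point of the orbit of 0 under z |-> z ^ d + c.  The
    map R_d keeps y - x ^ d constant, and along the orbit of (0, c, 0) this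
    constant is c; hence the first two coordinates run through the orbit of 0.
    The third coordinate obeys the recursion of the derivative of a_k in c.
    So the k-th iterate of (0, c, 0) is (a_k(c), a_(k+1)(c), a_k'(c)), see
    [iter_Rmap], and (0, c, 0) is a periodic point as soon as c is a multiple
    root of some a_n with n > 0.  The subvariety is the line x = z = 0.  It is
    not periodic: for every N > 0 the polynomial a_N is monic, so it does not
    vanish at all points of the infinite field K.

    It remains to find infinitely many values of c.  If p divides the
    discriminant of the Gleason polynomial G_n, then G_n mod p has a multiple
    root c in K ([double_root_of_disc_eq0]).  The main point is that such a c
    is a multiple root of a_n and that 0 has exact period n for c, so that
    distinct n give distinct c.  Both follow from a count of multiplicities
    valid in every characteristic.  Let m be the exact period of 0 for c.
    Modulo a_m ^ d, the sequence a_k is m-periodic for k > 0; as d > 1, all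
    a_(jm) with j > 0 have at c the multiplicity e of a_m, while the other a_k
    do not vanish at c ([mup_crit_poly]).  The multiplicity of G_n at c is
    therefore e times the sum of mu(n / k) over the k with m | k | n
    ([gleason_root]), and by Moebius inversion this is e if n = m and 0
    otherwise ([sum_mobius_divn]). *)

(** * Sums of the Moebius function *)

Lemma mobius_mul_prime (q i : nat) :
  prime q -> (0 < i)%N -> ~~ (q %| i)%N -> mobius (q * i) = - mobius i.
Proof.
move=> q_pr i_gt0 qNi; have q_gt0 := prime_gt0 q_pr.
have qNprimes : q \notin primes i.
  by rewrite mem_primes (negPf qNi) !andbF.
have eq_primes : perm_eq (primes (q * i)) (q :: primes i).
  apply: uniq_perm; rewrite ?primes_uniq //= ?qNprimes ?primes_uniq // => r.
  by rewrite primesM // primes_prime // !inE.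
rewrite /mobius (perm_all _ eq_primes) (perm_size eq_primes) /=.
rewrite lognM // logn_prime // eqxx /= (_ : logn q i = 0%N); last first.
  by rewrite lognE q_pr i_gt0 /= (negPf qNi).
rewrite (eq_in_all (a2 := fun r => logn r i == 1%N)); last first.
  move=> r r_in; rewrite lognM // logn_prime //.
  by case: (eqVneq r q) r_in => // ->; rewrite (negPf qNprimes).
by case: (all _ _); rewrite ?oppr0 ?exprS ?mulN1r.
Qed.

Lemma mobius_nonsquarefree (q j : nat) :
  prime q -> (0 < j)%N -> (q ^ 2 %| j)%N -> mobius j = 0.
Proof.
move=> q_pr j_gt0 q2_j; rewrite /mobius ifF //.
apply: contraTF q2_j => /allP log1; rewrite pfactor_dvdn // -ltnNge ltnS.
have [/log1/eqP->//|] := boolP (q \in primes j).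
by rewrite -logn_gt0 -leqNgt => /leq_trans->.
Qed.

(** For a prime divisor q of n, the squarefree divisors of n come in pairs
    i, q * i with q not dividing i, and the two terms of a pair cancel. *)
Lemma sum_mobius_eq0 (n : nat) :
  (1 < n)%N -> \sum_(j <- divisors n) mobius j = 0.
Proof.
move=> n_gt1; have n_gt0 : (0 < n)%N by apply: ltnW.
have [q q_pr q_n] : exists2 q, prime q & (q %| n)%N.
  by exists (pdiv n); rewrite ?pdiv_prime ?pdiv_dvd.
have q_gt0 := prime_gt0 q_pr.
pose simple j := (q %| j)%N && ~~ (q ^ 2 %| j)%N.
have mult_sub : perm_eq [seq (q * i)%N | i <- divisors n & ~~ (q %| i)%N]
                        [seq j <- divisors n | simple j].
  apply: uniq_perm; rewrite ?filter_uniq ?divisors_uniq //.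
    rewrite map_inj_in_uniq ?filter_uniq ?divisors_uniq // => x y _ _ /eqP.
    by rewrite eqn_pmul2l // => /eqP.
  move=> j; rewrite mem_filter -dvdn_divisors //; apply/mapP/idP => [[i]|].
    rewrite mem_filter -dvdn_divisors // => /andP[qNi i_n] ->.
    rewrite /simple dvdn_mulr //= expnS expn1 dvdn_pmul2l // qNi /=.
    by rewrite Gauss_dvd ?prime_coprime // q_n.
  case/andP=> /andP[/dvdnP[i ->] q2Nj] j_n; exists i; last by rewrite mulnC.
  rewrite mem_filter -dvdn_divisors // (dvdn_trans _ j_n) ?dvdn_mulr // andbT.
  by apply: contra q2Nj => q_i; rewrite expnS expn1 dvdn_pmul2r.
rewrite (bigID (fun j => q %| j)%N) /= (bigID (fun j => q ^ 2 %| j)%N) /=.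
rewrite big1_seq => [|j /andP[/andP[_ q2j]]]; last first.
  rewrite -dvdn_divisors // => j_n.
  by rewrite (mobius_nonsquarefree q_pr _ q2j) // (dvdn_gt0 n_gt0 j_n).
rewrite add0r -[X in X + _]big_filter -(perm_big _ mult_sub) big_map big_filter.
rewrite -big_split big1_seq //= => i /andP[qNi]; rewrite -dvdn_divisors // => i_n.
by rewrite mobius_mul_prime ?addNr // (dvdn_gt0 n_gt0 i_n).
Qed.

(** The involution k |-> n / k turns the range into the divisors of n / m. *)
Lemma sum_mobius_divn (n m : nat) : (0 < n)%N -> (m %| n)%N ->
  \sum_(k <- divisors n | (m %| k)%N) mobius (n %/ k) = (m == n)%:R.
Proof.
move=> n_gt0 m_n; have [->|m_neq_n] := eqVneq m n.
  rewrite (big_rem n) ?divisors_id //= dvdnn divnn n_gt0 big1_seq ?addr0 //.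
  move=> k /andP[n_k]; rewrite mem_rem_uniq ?divisors_uniq // !inE.
  by rewrite -dvdn_divisors // eqn_dvd n_k andbT => /andP[/negP].
have m_gt0 := dvdn_gt0 n_gt0 m_n.
have [N def_n] := dvdnP m_n; have N_gt0 : (0 < N)%N.
  by move: n_gt0; rewrite def_n muln_gt0 => /andP[].
have N_gt1 : (1 < N)%N.
  rewrite ltn_neqAle N_gt0 andbT; apply: contra m_neq_n => /eqP N1.
  by rewrite def_n -N1 mul1n.
rewrite -[RHS](sum_mobius_eq0 N_gt1) -big_filter.
rewrite -(big_map (fun k => n %/ k)%N predT mobius).
apply: perm_big; apply: uniq_perm; rewrite ?divisors_uniq //.
  rewrite map_inj_in_uniq ?filter_uniq ?divisors_uniq // => x y.
  rewrite !mem_filter -!dvdn_divisors // => /andP[_ x_n] /andP[_ y_n] eq_div.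
  have nx_gt0 : (0 < n %/ x)%N.
    by rewrite divn_gt0 ?(dvdn_gt0 n_gt0 x_n) // (dvdn_leq n_gt0 x_n).
  apply/eqP; rewrite -(eqn_pmul2l nx_gt0).
  by rewrite divnK // eq_div divnK.
move=> j; rewrite -dvdn_divisors //; apply/mapP/idP => [[k]|j_N].
  rewrite mem_filter -dvdn_divisors // => /andP[/dvdnP[b ->] /dvdnP[a]] def_n2 ->.
  have b_gt0 : (0 < b)%N.
    by move: n_gt0; rewrite def_n2; case: b {def_n2} => //; rewrite muln0.
  rewrite def_n2 mulnK ?muln_gt0 ?b_gt0 //.
  apply/dvdnP; exists b; apply/eqP; rewrite -(eqn_pmul2r m_gt0) -def_n def_n2.
  by rewrite mulnA (mulnC b).
have j_gt0 := dvdn_gt0 N_gt0 j_N; have [b def_N] := dvdnP j_N.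
have bm_gt0 : (0 < b * m)%N.
  by move: n_gt0; rewrite def_n def_N !muln_gt0 m_gt0; case: b {def_N}.
exists (b * m)%N; last by rewrite def_n def_N -mulnA (mulnC j) mulnA mulKn.
rewrite mem_filter -dvdn_divisors // dvdn_mull //=.
by rewrite def_n def_N -mulnA (mulnC j) mulnA dvdn_mulr.
Qed.

(** * Reduction of the discriminant *)

(** The degree of q may drop under f, as happens for the derivative in
    positive characteristic, so the determinant of the reduced Sylvester matrix
    need not be a resultant.  The usual argument survives: a vector in the kernel
    is a relation u P + v Q = 0 with v of degree less than that of P, so for
    coprime P and Q the polynomial P divides v, whence v = 0 and u = 0. *)
Lemma coprimep_map_resultant_neq0 (A : nzRingType) (F : fieldType)
    (f : {rmorphism A -> F}) (p q : {poly A}) :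
  size (map_poly f p) = size p -> p != 0 ->
  coprimep (map_poly f p) (map_poly f q) -> \det (map_mx f (Sylvester_mx p q)) != 0.
Proof.
set P := map_poly f p; set Q := map_poly f q => size_P p_nz co_PQ.
have P_nz : P != 0 by rewrite -size_poly_gt0 size_P size_poly_gt0.
have size_Q : (size Q <= size q)%N by apply: size_poly.
apply/negP => /det0P[uv uv_nz].
have map_band m n (r : {poly A}) :
  map_mx f (lin1_mx (@poly_rV A n \o r \o* (@rVpoly A m)))
  = lin1_mx (@poly_rV F n \o map_poly f r \o* (@rVpoly F m)).
  by apply: map_lin1_mx => v /=; rewrite map_poly_rV rmorphM /= map_rVpoly.
rewrite /Sylvester_mx map_col_mx !map_band -[uv]hsubmxK mul_row_col !mul_rV_lin1 /=.
set u := rVpoly _; set v := rVpoly _.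
have size_v : (size v < size P)%N.
  by rewrite size_P (polySpred p_nz) ltnS size_poly.
move/(congr1 rVpoly); rewrite -linearD linear0 poly_rV_K => [uPvQ|]; last first.
  rewrite (leq_trans (size_polyD _ _)) // geq_max.
  rewrite !(leq_trans (size_polyMleq _ _)) // -subn1 leq_subLR.
    by rewrite addnC addnA leq_add ?(leq_trans size_Q) ?leqSpred ?size_poly.
  by rewrite addnCA -/P size_P leq_add ?leqSpred ?size_poly.
have P_v : P %| v.
  by rewrite -(Gauss_dvdpl v co_PQ) -(dvdp_addr _ (dvdp_mulIr u P)) uPvQ dvdp0.
have v0 : v = 0.
  by apply/eqP; apply: contraLR size_v => v_nz; rewrite -leqNgt dvdp_leq.
have u0 : u = 0.
  move/eqP: uPvQ; rewrite v0 mul0r addr0 mulf_eq0 (negPf P_nz) orbF.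
  by move/eqP.
case/eqP: uv_nz; rewrite -[uv]hsubmxK -row_mx0.
by congr row_mx; apply: (can_inj rVpolyK); rewrite linear0.
Qed.

(** For monic g the discriminant is, up to sign, the resultant of g and g', so
    it is the Sylvester determinant of this pair that vanishes in K. *)
Lemma double_root_of_disc_eq0 (K : closedFieldType)
    (p : nat) (g : {poly int}) :
    p \in [pchar K] -> g \is monic -> (p%:Z %| disc g)%Z ->
  exists2 c : K, root (map_poly intr g) c & root (map_poly intr g)^`() c.
Proof.
move=> charKp g_monic; rewrite /disc (monicP g_monic) divz1 => /dvdzP[b def_disc].
set P := map_poly _ g.
have size_P : size P = size g.
  by rewrite size_map_poly_id0 // (monicP g_monic) rmorph1 oner_neq0.
have : ((resultant g g^`())%:~R : K) = 0.
  have /(congr1 (fun z : int => z%:~R : K)) := def_disc.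
  rewrite [in RHS]rmorphM /= -pmulrn (pcharf0 charKp) mulr0 rmorphM /= rmorphXn /=.
  by move/eqP; rewrite rmorphN1 mulf_eq0 signr_eq0 => /eqP.
rewrite /resultant -det_map_mx => /eqP det0.
have : ~~ coprimep P P^`().
  apply: contraTN det0 => co_P; apply: coprimep_map_resultant_neq0 => //.
    exact: monic_neq0.
  by rewrite -deriv_map.
move/closed_rootP => [c]; rewrite root_gcd => /andP[Pc P'c].
by exists c.
Qed.

(** * The orbit of the critical point as a polynomial in the parameter *)

Definition crit_poly (A : comNzRingType) (d k : nat) : {poly A} :=
  iter k (fdc d 'X) 0.
Arguments crit_poly : simpl never.

Lemma crit_polyS (A : comNzRingType) (d k : nat) :
  crit_poly A d k.+1 = crit_poly A d k ^+ d + 'X.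
Proof. by []. Qed.

Lemma horner_crit_polyS (A : comNzRingType) (d k : nat) (c : A) :
  (crit_poly A d k.+1).[c] = (crit_poly A d k).[c] ^+ d + c.
Proof. by rewrite crit_polyS hornerD horner_exp hornerX. Qed.

Lemma map_crit_poly (A B : comNzRingType) (f : {rmorphism A -> B}) (d k : nat) :
  map_poly f (crit_poly A d k) = crit_poly B d k.
Proof.
elim: k => [|k IHk]; first exact: rmorph0.
by rewrite !crit_polyS rmorphD rmorphXn /= IHk map_polyX.
Qed.

Lemma crit_poly_monic (A : idomainType) (d k : nat) :
  (1 < d)%N -> (0 < k)%N -> crit_poly A d k \is monic.
Proof.
move=> d_gt1; case: k => // k _.
suff [] : crit_poly A d k.+1 \is monic /\ (1 < size (crit_poly A d k.+1))%N by [].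
elim: k => [|k [a_monic size_a]].
  by rewrite crit_polyS expr0n gtn_eqF ?(ltnW d_gt1) // add0r monicX size_polyX.
set a := crit_poly A d k.+1 in a_monic size_a.
have size_ad : (size ('X : {poly A}) < size (a ^+ d)%R)%N.
  have : (1 < (size (a ^+ d)%R).-1)%N.
    by rewrite size_exp (leq_trans d_gt1) // leq_pmull // -subn1 subn_gt0.
  by rewrite size_polyX; case: (size _).
rewrite crit_polyS -/a; split.
  by rewrite monicE lead_coefDl // (monicP (monic_exp d a_monic)).
by rewrite size_polyDl // (leq_ltn_trans _ size_ad) // size_polyX.
Qed.

Lemma fdc_sub (A : comNzRingType) (d : nat) (c z w : A) :
  fdc d c z - fdc d c w = z ^+ d - w ^+ d.
Proof. by rewrite /fdc opprD addrACA subrr addr0. Qed.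

(** Already one application of z |-> z ^ d + c turns u - w into u ^ d - w ^ d,
    and later iterates keep every divisor of a difference. *)
Lemma iter_fdc_sub_dvdp (F : fieldType) (d k : nat) (u w : {poly F}) :
  u ^+ d - w ^+ d %| iter k.+1 (fdc d 'X) u - iter k.+1 (fdc d 'X) w.
Proof.
elim: k => [|k IHk]; first by rewrite /= fdc_sub.
apply: dvdp_trans IHk _; rewrite !(iterS k.+1) fdc_sub subrXX.
exact: dvdp_mulr.
Qed.

(** The case u = a_m, w = 0 above: modulo a_m ^ d the orbit closes up after m
    steps.  The exponent d, rather than 1, comes from 0 being critical, and it
    is what makes multiplicities of roots constant along the orbit. *)
Lemma crit_poly_add_dvdp (F : fieldType) (d m k : nat) :
  (0 < d)%N -> (0 < k)%N ->
  crit_poly F d m ^+ d %| crit_poly F d (k + m) - crit_poly F d k.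
Proof.
move=> d_gt0; case: k => // k _; rewrite /crit_poly iterD.
have := iter_fdc_sub_dvdp d k (crit_poly F d m) 0.
by rewrite expr0n gtn_eqF // subr0.
Qed.

(** The roots of the k-th orbit polynomial are the parameters c for which 0
    returns to itself after k steps, so this is the period of 0 for c. *)
Definition exact_period (F : fieldType) (d n : nat) (c : F) : Prop :=
  [/\ (0 < n)%N, root (crit_poly F d n) c
    & forall k, (0 < k < n)%N -> ~~ root (crit_poly F d k) c].

Lemma exact_period_exists (F : fieldType) (d n : nat) (c : F) :
  (0 < n)%N -> root (crit_poly F d n) c -> exists m, exact_period d m c.
Proof.
move=> n_gt0 n_root.
have ex_k : exists k, (0 < k)%N && root (crit_poly F d k) c.
  by exists n; rewrite n_gt0.
have [m /andP[m_gt0 m_root] m_min] := ex_minnP ex_k; exists m; split=> // k.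
case/andP=> k_gt0 k_m; apply: contraL k_m => k_root.
by rewrite -leqNgt m_min // k_gt0.
Qed.

Lemma root_crit_poly_add (F : fieldType) (d m k : nat) (c : F) :
  (0 < d)%N -> root (crit_poly F d m) c ->
  root (crit_poly F d (k + m)) c = root (crit_poly F d k) c.
Proof.
move=> d_gt0 m_root; case: k => [|k]; first by rewrite add0n m_root root0.
have := @crit_poly_add_dvdp F d m k.+1 d_gt0 isT.
rewrite -!dvdp_XsubCl in m_root * => dvd_diff.
rewrite -[crit_poly F d (k.+1 + m)](subrK (crit_poly F d k.+1)) dvdp_addr //.
by apply: dvdp_trans dvd_diff; rewrite dvdp_exp.
Qed.

Lemma exact_period_dvdn (F : fieldType) (d m k : nat) (c : F) :
  (0 < d)%N -> exact_period d m c -> root (crit_poly F d k) c = (m %| k)%N.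
Proof.
move=> d_gt0 [m_gt0 m_root m_min].
have -> : root (crit_poly F d k) c = root (crit_poly F d (k %% m)) c.
  rewrite {1}(divn_eq k m) addnC; elim: (k %/ m)%N => [|b IHb].
    by rewrite mul0n addn0.
  by rewrite mulSn (addnC m) addnA root_crit_poly_add.
rewrite /dvdn; case: posnP => [->|r_gt0]; first exact: root0.
by apply/negbTE/m_min; rewrite r_gt0 ltn_pmod.
Qed.

Lemma exact_period_inj (F : fieldType) (d m n : nat) (c : F) :
  (0 < d)%N -> exact_period d m c -> exact_period d n c -> m = n.
Proof.
move=> d_gt0 m_per n_per; apply/eqP; rewrite eqn_dvd.
rewrite -(exact_period_dvdn _ d_gt0 m_per) -(exact_period_dvdn _ d_gt0 n_per).
by case: m_per n_per => [_ -> _] [_ ->].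
Qed.

(** The ultrametric equality for the order of vanishing at c. *)
Lemma mup_addl (F : fieldType) (c : F) (p q : {poly F}) :
  p != 0 -> ('X - c%:P) ^+ (mup c p).+1 %| q -> mup c (p + q) = mup c p.
Proof.
move=> p_nz dvd_q; have dvd_p : ('X - c%:P) ^+ mup c p %| p by rewrite -mup_geq.
have dvd_q' : ('X - c%:P) ^+ mup c p %| q.
  by apply: dvdp_trans dvd_q; rewrite dvdp_exp2l.
have Ndvd_p : ~~ (('X - c%:P) ^+ (mup c p).+1 %| p) by rewrite -mup_leq.
have pq_nz : p + q != 0.
  apply: contraNneq Ndvd_p => pq0.
  by rewrite -(dvdp_addl p dvd_q) pq0 dvdp0.
apply/eqP; rewrite eqn_leq mup_leq // mup_geq // (dvdp_add dvd_p dvd_q') andbT.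
by rewrite dvdp_addl.
Qed.

(** With e the multiplicity of a_m at c, the difference of a_(jm + m) and a_(jm)
    vanishes to order e * d > e, so the multiplicity e propagates from a_(jm) to
    a_(jm + m). *)
Lemma mup_crit_poly (F : fieldType) (d m k : nat) (c : F) :
  (1 < d)%N -> (0 < k)%N -> exact_period d m c ->
  mup c (crit_poly F d k) = ((m %| k) * mup c (crit_poly F d m))%N.
Proof.
move=> d_gt1 k_gt0 m_per; have d_gt0 := ltnW d_gt1.
case: (boolP (m %| k)%N) => [|mNk]; last first.
  by rewrite mul0n mupNroot // (exact_period_dvdn _ d_gt0 m_per).
case/dvdnP=> b def_k; rewrite {k}def_k in k_gt0 *; rewrite mul1n.
have [m_gt0 m_root _] := m_per.
set e := mup c (crit_poly F d m).
have am_nz : crit_poly F d m != 0 by rewrite monic_neq0 ?crit_poly_monic.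
have e_gt0 : (0 < e)%N by rewrite -XsubC_dvd // dvdp_XsubCl.
case: b k_gt0 => // b _; elim: b => [|b IHb]; first by rewrite mul1n.
have bm_gt0 : (0 < b.+1 * m)%N by rewrite muln_gt0.
rewrite mulSn addnC.
set abm := crit_poly F d (b.+1 * m) in IHb.
rewrite -[crit_poly _ _ _](subrK abm) addrC mup_addl ?IHb //.
  by rewrite monic_neq0 ?crit_poly_monic.
apply: dvdp_trans (crit_poly_add_dvdp F m d_gt0 bm_gt0).
apply: (@dvdp_trans _ (('X - c%:P) ^+ e ^+ d)).
  rewrite -exprM dvdp_exp2l // -[e.+1]addn1 (leq_trans (_ : _ <= e * 2)%N) //.
    by rewrite muln2 -addnn leq_add2l.
  by rewrite leq_mul2l d_gt1 orbT.
by rewrite dvdp_exp2r // -mup_geq.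
Qed.

Lemma mup_prod (F : fieldType) (I : eqType) (r : seq I) (a : I -> nat)
    (P : I -> {poly F}) (c : F) : {in r, forall i, P i != 0} ->
  mup c (\prod_(i <- r) P i ^+ a i) = (\sum_(i <- r) a i * mup c (P i))%N.
Proof.
move=> P_nz; have mup1 : mup c (1 : {poly F}) = 0%N by rewrite mupNroot ?root1.
rewrite !(big_seq_cond (fun=> true)) /=.
pose Q (p : {poly F}) k := p != 0 /\ mup c p = k.
suff [] : Q (\prod_(i <- r | (i \in r) && true) P i ^+ a i)
            (\sum_(i <- r | (i \in r) && true) a i * mup c (P i))%N by [].
apply: (big_rec2 Q) => [|i k p /andP[/P_nz Pi_nz _] [p_nz <-]].
  by split; rewrite ?oner_neq0.
split; first by rewrite mulf_neq0 // expf_neq0.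
rewrite mupM ?expf_neq0 //; congr (_ + _)%N.
elim: (a i) => [|n IHn]; first by rewrite mup1.
by rewrite exprS mupM ?expf_neq0 // IHn mulSn.
Qed.

(** * Multiplicities of the roots of Gleason polynomials *)

Definition pos_part (z : int) : nat := if z is Posz n then n else 0%N.
Definition neg_part (z : int) : nat := if z is Negz n then n.+1 else 0%N.

Lemma int_parts (z : int) : z = (pos_part z)%:Z - (neg_part z)%:Z.
Proof. by case: z => n; rewrite /= ?subr0 // sub0r NegzE. Qed.

Lemma exprz_parts (F : fieldType) (x : F) (z : int) :
  x != 0 -> x ^ z * x ^+ neg_part z = x ^+ pos_part z.
Proof.
move=> x_nz; case: z => j; first by rewrite mulr1.
by rewrite /= mulVf // expf_neq0.
Qed.

(** Clearing denominators turns the defining fraction into an identity of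
    polynomials, which can then be reduced modulo p.  The alternative 1 is the
    default value of the choice operator; it is monic and has no roots, so it
    satisfies the statements below as well. *)
Lemma gleason_mul (d n : nat) : (1 < d)%N -> (0 < n)%N ->
  gleason d n = 1 \/
  gleason d n *
    \prod_(k <- divisors n) crit_orbit d k ^+ neg_part (mobius (n %/ k))
  = \prod_(k <- divisors n) crit_orbit d k ^+ pos_part (mobius (n %/ k)).
Proof.
move=> d_gt1 n_gt0; rewrite /gleason.
case: xgetP => [g _ /= def_g|_]; [right | by left].
apply/eqP; rewrite -tofrac_eq tofracM def_g /gleason_frac !rmorph_prod -big_split.
apply/eqP/eq_big_seq => k; rewrite -dvdn_divisors // => k_n /=.
have ak_nz : tofrac (crit_orbit d k) != 0.
  rewrite tofrac_eq0 monic_neq0 //.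
  by apply: crit_poly_monic => //; apply: dvdn_gt0 n_gt0 k_n.
by rewrite !tofracXn exprz_parts.
Qed.

Lemma gleason_monic (d n : nat) :
  (1 < d)%N -> (0 < n)%N -> gleason d n \is monic.
Proof.
move=> d_gt1 n_gt0.
have prod_monic (a : nat -> nat) :
  \prod_(k <- divisors n) crit_orbit d k ^+ a k \is monic.
  rewrite big_seq; apply: monic_prod => k; rewrite -dvdn_divisors // => k_n.
  by rewrite monic_exp // [_ \is monic]crit_poly_monic // (dvdn_gt0 n_gt0 k_n).
have [->|gleasonM] := gleason_mul d_gt1 n_gt0; first exact: monic1.
by rewrite -(monicMr _ (prod_monic (fun k => neg_part (mobius (n %/ k))))) gleasonM.
Qed.

(** Taking multiplicities at c in the product formula leaves e times the sum of
    mu(n / k) over m | k | n, where m is the exact period for c and e is the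
    multiplicity of a_m.  It is positive, and this forces m = n. *)
Lemma gleason_root (F : fieldType) (d n : nat) (c : F) :
  (1 < d)%N -> (0 < n)%N -> root (map_poly intr (gleason d n)) c ->
  exact_period d n c /\
  mup c (map_poly intr (gleason d n)) = mup c (crit_poly F d n).
Proof.
move=> d_gt1 n_gt0; set g := map_poly _ _; have d_gt0 := ltnW d_gt1.
have [g1|gleasonM] := gleason_mul d_gt1 n_gt0.
  by rewrite /g g1 rmorph1 (negPf (root1 c)).
move=> g_root; have g_nz : g != 0.
  by rewrite monic_neq0 // monic_map ?gleason_monic.
pose v k := mup c (crit_poly F d k).
have a_nz : {in divisors n, forall k, crit_poly F d k != 0}.
  move=> k; rewrite -dvdn_divisors // => k_n.
  by rewrite monic_neq0 // crit_poly_monic // (dvdn_gt0 n_gt0 k_n).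
have mup_g : (mup c g)%:Z = \sum_(k <- divisors n) mobius (n %/ k) * (v k)%:Z.
  have map_prod (a : nat -> nat) :
      map_poly intr (\prod_(k <- divisors n) crit_orbit d k ^+ a k)
      = \prod_(k <- divisors n) crit_poly F d k ^+ a k.
    rewrite rmorph_prod; apply: eq_bigr => k _.
    by rewrite rmorphXn /= [map_poly _ _]map_crit_poly.
  have prod_nz (a : nat -> nat) :
      \prod_(k <- divisors n) crit_poly F d k ^+ a k != 0.
    by rewrite prodf_seq_neq0; apply/allP => k /a_nz ak_nz; rewrite expf_neq0.
  have /(congr1 (mup c \o map_poly intr)) /= := gleasonM.
  rewrite rmorphM /= !map_prod -/g mupM // !mup_prod // => sum_eq.
  rewrite (eq_bigr (fun k => (pos_part (mobius (n %/ k)) * v k)%N%:Z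
                           - (neg_part (mobius (n %/ k)) * v k)%N%:Z)); last first.
    by move=> k _; rewrite {1}[mobius _]int_parts mulrBl !PoszM.
  rewrite sumrB; apply/eqP; rewrite eq_sym subr_eq.
  by rewrite -!(big_morph Posz PoszD (erefl _)) -sum_eq PoszD.
have [/hasP[k k_div k_root]|no_root] :=
    boolP (has (fun k => root (crit_poly F d k) c) (divisors n)); last first.
  have : (0 < mup c g)%N by rewrite -XsubC_dvd // dvdp_XsubCl.
  rewrite -ltz_nat mup_g big1_seq // => k /andP[_ k_div].
  by rewrite /v mupNroot ?mulr0 //; apply: (hasPn no_root).
have k_n : (k %| n)%N by rewrite dvdn_divisors.
have [m m_per] := exact_period_exists (dvdn_gt0 n_gt0 k_n) k_root.
have m_n : (m %| n)%N.
  by apply: dvdn_trans k_n; rewrite -(exact_period_dvdn _ d_gt0 m_per).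
move: mup_g; rewrite (eq_big_seq (fun j =>
    (if (m %| j)%N then mobius (n %/ j) else 0) * (v m)%:Z)); last first.
  move=> j; rewrite -dvdn_divisors // => j_n.
  rewrite {1}/v (mup_crit_poly d_gt1 (dvdn_gt0 n_gt0 j_n) m_per).
  by case: (m %| j)%N; rewrite ?mul1n ?mul0n ?mulr0 ?mul0r.
rewrite -mulr_suml -big_mkcond sum_mobius_divn //.
have [<-|_] := eqVneq m n; first by rewrite mul1r => -[].
rewrite mul0r => -[mup_g0]; have := XsubC_dvd c g_nz.
by rewrite mup_g0 dvdp_XsubCl g_root.
Qed.

Lemma mup_gt1 (F : fieldType) (p : {poly F}) (c : F) : p != 0 ->
  (1 < mup c p)%N = root p c && root p^`() c.
Proof.
move=> p_nz; rewrite mup_geq //; apply/idP/andP => [/dvdpP[q ->]|[]].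
  rewrite /root expr2 mulrA derivM hornerD !hornerM hornerXsubC subrr.
  by rewrite !(mulr0, mul0r) addr0.
case/factor_theorem=> q ->; rewrite /root derivM derivXsubC mulr1 hornerD hornerM.
rewrite hornerXsubC subrr mulr0 add0r => q_root.
by rewrite expr2 dvdp_mul // dvdp_XsubCl.
Qed.

Lemma disc_root (K : closedFieldType) (d p n : nat) :
  (1 < d)%N -> (0 < n)%N -> p \in [pchar K] -> (p%:Z %| gleason_disc d n)%Z ->
  exists2 c : K, exact_period d n c & root (crit_poly K d n)^`() c.
Proof.
move=> d_gt1 n_gt0 charKp /(double_root_of_disc_eq0 charKp).
case=> [|c g_root g'_root]; first exact: gleason_monic.
have [c_per mup_g] := gleason_root d_gt1 n_gt0 g_root.
exists c => //.
have : (1 < mup c (crit_poly K d n))%N.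
  rewrite -mup_g mup_gt1 ?g_root //.
  by rewrite monic_neq0 // monic_map ?gleason_monic.
by rewrite mup_gt1 ?monic_neq0 ?crit_poly_monic // => /andP[].
Qed.

(** * The dynamics of the map on the affine space *)

(** The second coordinate uses y - x ^ d = c, the third is the chain rule for
    the derivative of a_k ^ d + c in c. *)
Lemma iter_Rmap (K : closedFieldType) (d k : nat) (c : K) : (0 < d)%N ->
  iter k (Rmap d) [tuple 0; c; 0] =
  [tuple (crit_poly K d k).[c]; (crit_poly K d k.+1).[c];
         (crit_poly K d k)^`().[c]].
Proof.
move=> d_gt0; elim: k => [|k IHk].
  apply/val_inj; rewrite /= horner_crit_polyS /crit_poly /= deriv0 !horner0.
  by rewrite expr0n gtn_eqF // add0r.
rewrite iterS IHk; apply/val_inj => /=; congr [:: _; _; _].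
  rewrite (horner_crit_polyS d k.+1) -addrA; congr (_ + _).
  by rewrite horner_crit_polyS addrAC subrr add0r.
rewrite crit_polyS derivD derivX deriv_exp hornerD hornerMn hornerM hornerC.
by rewrite horner_exp -mulrA mulr_natl mulrC.
Qed.

Definition critical_line (K : closedFieldType) : set (3.-tuple K) :=
  [set v | v`_0 = 0 /\ v`_2 = 0].

Definition line_restriction (K : closedFieldType) (q : {mpoly K[3]}) : {poly K} :=
  mmap polyC (tnth [tuple 0; 'X; 0]) q.

Lemma horner_line_restriction (K : closedFieldType) (q : {mpoly K[3]}) (y : K) :
  (line_restriction q).[y] = q.@[tnth [tuple 0; y; 0]].
Proof.
rewrite /line_restriction /meval /mmap horner_sum; apply: eq_bigr => m _.
rewrite hornerM hornerC /mmap1 horner_prod; congr (_ * _).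
apply: eq_bigr => i _; rewrite horner_exp; congr (_ ^+ _).
by rewrite !(tnth_nth 0); case: i => [[|[|[|i]]]] //= _; rewrite !hornerE.
Qed.

Lemma critical_lineP (K : closedFieldType) (v : 3.-tuple K) :
  critical_line v -> v = [tuple 0; v`_1; 0].
Proof.
case: v => [[|x [|y [|z [|? ?]]]] //= sz] [/= -> ->].
by apply/val_inj.
Qed.

(** Restricting equations to the line gives polynomials in one variable, and a
    product of two nonzero ones has a nonroot in K; hence irreducibility. *)
Lemma critical_line_subvariety (K : closedFieldType) :
  subvariety (@critical_line K).
Proof.
split.
  exists [set q | q = 'X_(inord 0) \/ q = 'X_(inord 2)].
  apply/seteqP; split=> v /=.
    by case=> x0 z0 q [] ->; rewrite mevalXU (tnth_nth 0) inordK.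
  move=> v_zero; split.
    have := v_zero _ (or_introl erefl).
    by rewrite mevalXU (tnth_nth 0) inordK.
  have := v_zero _ (or_intror erefl).
  by rewrite mevalXU (tnth_nth 0) inordK.
split; first by exists [tuple 0; 0; 0].
move=> _ _ [S ->] [T ->] V_sub.
have [VS|/existsNP[v /not_implyP[Vv /existsNP[q /not_implyP[Sq qv]]]]] :=
  pselect (@critical_line K `<=` zero_locus S); first by left.
right=> w Vw r Tr; apply: contrapT => rw.
have : line_restriction q * line_restriction r != 0.
  apply/mulf_neq0; apply/eqP => /(congr1 (horner^~ _)) q0.
    apply: qv; rewrite (critical_lineP Vv) -horner_line_restriction q0.
    by rewrite horner0.
  apply: rw; rewrite (critical_lineP Vw) -horner_line_restriction q0.
  by rewrite horner0.
case/closed_nonrootP=> y; rewrite rootM negb_or => /andP[qy ry].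
have /V_sub[] : critical_line [tuple 0; y; 0] by [].
  by move=> /(_ q Sq) q0; case/rootP: qy; rewrite horner_line_restriction.
by move=> /(_ r Tr) r0; case/rootP: ry; rewrite horner_line_restriction.
Qed.

Lemma critical_line_nonperiodic (K : closedFieldType) (d : nat) :
  (1 < d)%N -> ~ periodic_subset (@Rmap K d) (@critical_line K).
Proof.
move=> d_gt1 [N N_gt0 sub].
have /closed_nonrootP[c] : crit_poly K d N != 0.
  by rewrite monic_neq0 ?crit_poly_monic.
case/eqP; have [] : critical_line (iter N (Rmap d) [tuple 0; c; 0]).
  by apply: sub; exists [tuple 0; c; 0].
by rewrite iter_Rmap // ltnW.
Qed.

Lemma double_root_periodic_point (K : closedFieldType) (d n : nat) (c : K) :
  (0 < d)%N -> (0 < n)%N ->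
  root (crit_poly K d n) c -> root (crit_poly K d n)^`() c ->
  periodic_point (@Rmap K d) [tuple 0; c; 0].
Proof.
move=> d_gt0 n_gt0 /eqP a_root /eqP a'_root; exists n => //.
rewrite iter_Rmap // a_root a'_root horner_crit_polyS a_root.
by rewrite expr0n gtn_eqF // add0r.
Qed.

(* K, with iota, is an algebraic closure of 'F_p. *)
Theorem corollary4p12 (d p : nat) (hd : (2 <= d)%N) (hp : prime p)
    (K : closedFieldType) (iota : {rmorphism 'F_p -> K})
    (halg : integralRange iota) :
  infinite_set [set n : nat | (0 < n)%N /\ (p%:Z %| gleason_disc d n)%Z] ->
  exists V : set (3.-tuple K),
    [/\ subvariety V,
        ~ periodic_subset (@Rmap K d) V &
        infinite_set [set v | V v /\ periodic_point (@Rmap K d) v]].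
Proof.
move=> inf_n; have d_gt0 := ltnW hd.
have charKp : p \in [pchar K] by rewrite (rmorph_pchar iota) // pchar_Fp.
exists (@critical_line K); split.
- exact: critical_line_subvariety.
- exact: critical_line_nonperiodic.
(* If these points were finitely many, so would be the periods of 0 for their
   parameters; but every n in the given set is such a period. *)
pose per (v : 3.-tuple K) := xget 0%N [set n | exact_period d n v`_1].
move=> fin_pts; apply: inf_n; apply: sub_finite_set (finite_image per fin_pts).
move=> n [n_gt0 p_disc].
have [c c_per a'_root] := disc_root hd n_gt0 charKp p_disc.
have [_ a_root _] := c_per.
exists [tuple 0; c; 0].
  by split=> //; apply: double_root_periodic_point a_root a'_root.
rewrite /per; apply: xget_unique => //= m m_per.
exact: exact_period_inj m_per c_per.
Qed.
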